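(* Let $S$ be a semigroup. Then $S$ is a finite medial semigroup such that the index of $\theta_S$ is $2$ and $P_{\theta_S}(S)=\frac{1}{2}$ if and only if $S$ is isomorphic to a semigroup of Type 1, Type 2, Type 3, or Type 4 (these types being defined in the context) whose constituent sets $A$ and $B$ satisfy, in each of the four cases, $|A|=|B|<\infty$.
   Context: A semigroup is a nonempty set with an associative multiplication. For a semigroup $S$, $\theta_S$ is the kernel of the right regular representation $a\mapsto \varrho_a$, $\varrho_a: x\mapsto xa$; that is, $(a,b)\in\theta_S$ if and only if $sa=sb$ for all $s\in S$. It is a congruence on $S$. The index of $\theta_S$ is the number $|S/\theta_S|$ of its classes. For a finite semigroup $S$, $P_{\theta_S}(S)$ is the probability that two elements $a,b$ selected (uniformly) at random from $S$, with replacement, satisfy $(a,b)\in\theta_S$, i.e. $P_{\theta_S}(S)=|\{(a,b)\in S\times S:(a,b)\in\theta_S\}|/|S|^2$. $S$ is medial if $axyb=ayxb$ for all $a,x,y,b\in S$. A left zero semigroup satisfies $ab=a$; a zero semigroup is a semigroup with a zero element $0$ satisfying $ab=0$. If $I$ is an ideal (nonempty, two-sided) of $S$, the Rees factor $S/I$ is obtained by collapsing $I$ to a single zero element. A retract homomorphism of $S$ onto an ideal $I$ is a homomorphism of $S$ onto $I$ leaving the elements of $I$ fixed; if one exists, $S$ is called a retract ideal extension of $I$ by $S/I$. If a semigroup $A$ is a retract ideal extension of a left zero semigroup $E_A$ by a zero semigroup (i.e. $A/E_A$ is a zero semigroup), and $\varphi_A$ is a retract homomorphism of $A$ onto $E_A$,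 then $E_A=A^2$ is the set of all idempotents of $A$ and $a_1a_2=\varphi_A(a_1)$ for all $a_1,a_2\in A$. The notation $E_B,\varphi_B$ is analogous for a semigroup $B$. All mappings act from the left: $(f\circ g)(x)=f(g(x))$. Type 1. Let $A$, $B$ be disjoint semigroups, each a retract ideal extension of a left zero semigroup ($E_A$, resp. $E_B$) by a zero semigroup, with retract homomorphisms $\varphi_A:A\to E_A$, $\varphi_B:B\to E_B$. Let $\alpha$ be a homomorphism of $A$ into $E_B$ and $\beta$ a homomorphism of $B$ into itself leaving the elements of $E_B$ fixed, such that $\alpha\circ\varphi_A=\alpha$, $\beta\circ\beta=\beta$, $\varphi_B\circ\beta=\varphi_B$. The semigroup is $A\cup B$ with the operation: $xy=\varphi_A(x)$ if $x,y\in A$; $xy=\alpha(x)$ if $x\in A,y\in B$; $xy=\beta(x)$ if $x\in B,y\in A$; $xy=\varphi_B(x)$ if $x,y\in B$. Type 2. Let $B$ be a semigroup which is a retract ideal extension of a left zero semigroup $E_B$ by a zero semigroup, with retract homomorphism $\varphi_B:B\to E_B$, and let $A$ be a nonempty set disjoint from $B$. Let $\alpha$ be a mapping of $A$ into $B$, $\beta$ a mapping of $A$ into $E_B$, and $\gamma$ a homomorphism of $B$ into itself leaving the elements of $E_B$ fixed. Assume that $\alpha\neq\beta$ or $\gamma\neq\varphi_B$, and that $\varphi_B\circ\alpha=\beta=\gamma\circ\alpha$ and $\varphi_B\circ\gamma=\varphi_B=\gamma\circ\gamma$. The semigroup is $A\cup B$ with the operation: $xy=\alpha(x)$ if $x,y\in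 A$; $xy=\beta(x)$ if $x\in A,y\in B$; $xy=\gamma(x)$ if $x\in B,y\in A$; $xy=\varphi_B(x)$ if $x,y\in B$. Type 3. Let $A$ be a semigroup which is a retract ideal extension of a left zero semigroup $E_A$ by a zero semigroup, with retract homomorphism $\varphi_A:A\to E_A$, and let $B$ be a nonempty set disjoint from $A$. Let $\alpha$ be a mapping of $A$ into $B$ and $\gamma$ a mapping of $B$ into $E_A$ such that $\alpha=\alpha\circ\varphi_A$ and $\gamma\circ\alpha=\varphi_A$. Put $\beta=\alpha\circ\gamma$. The semigroup is $A\cup B$ with the operation: $xy=\varphi_A(x)$ if $x,y\in A$; $xy=\alpha(x)$ if $x\in A,y\in B$; $xy=\beta(x)$ if $x\in B,y\in A$; $xy=\gamma(x)$ if $x,y\in B$. Type 4. Let $A$, $B$ be disjoint semigroups, each a retract ideal extension of a left zero semigroup ($E_A$, resp. $E_B$) by a zero semigroup, with retract homomorphisms $\varphi_A:A\to E_A$, $\varphi_B:B\to E_B$. Let $\alpha$ be a homomorphism of $A$ into $E_B$ and $\beta$ a homomorphism of $B$ into $E_A$ such that $\alpha\circ\varphi_A=\alpha=\varphi_B\circ\alpha$, $\beta\circ\varphi_B=\beta=\varphi_A\circ\beta$, $\alpha\circ\beta=\varphi_B$, $\beta\circ\alpha=\varphi_A$. The semigroup is $A\cup B$ with the operation: $xy=\varphi_A(x)$ if $x,y\in A$; $xy=\alpha(x)$ if $x\in A,y\in B$; $xy=\beta(x)$ if $x\in B,y\in A$; $xy=\varphi_B(x)$ if $x,y\in B$. 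*)

(* Defs.v *)
From HB Require Import structures.
From mathcomp Require Import all_boot all_order all_algebra finmap.
From mathcomp Require Import boolp classical_sets functions cardinality.

Set Implicit Arguments.
Unset Strict Implicit.
Unset Printing Implicit Defensive.

Local Open Scope classical_set_scope.
Local Open Scope group_scope.

(* A semigroup is a [semigroupType]; since this interface allows an empty
   carrier, nonemptiness is always stated (or implied by the existence of an
   ideal) separately. *)

Definition medial (S : semigroupType) : Prop :=
  forall a x y b : S, a * x * y * b = a * y * x * b.

Definition theta (S : semigroupType) (a b : S) : Prop :=
  forall s : S, s * a = s * b.

Definition theta_classes (S : semigroupType) : set (set S) :=
  [set [set b | theta a b] | a in [set: S]].
Arguments theta_classes S : clear implicits.

Definition theta_index_is (S : semigroupType) (n : nat) : Prop :=
  (theta_classes S #= `I_n)%card.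

(* Meaningful for finite S only: [fset_set] of an infinite set is empty. *)
Definition theta_prob (S : semigroupType) : rat :=
  (#|` fset_set [set p : S * S | theta p.1 p.2]|%:R
     / #|` fset_set [set: S]|%:R ^+ 2)%R.

Definition isomorphic (S T : magmaType) : Prop :=
  exists2 f : S -> T, bijective f & {morph f : x y / x * y}.

Definition ideal (A : semigroupType) (I : set A) : Prop :=
  I !=set0 /\ forall x a, I x -> I (a * x) /\ I (x * a).

Definition left_zero (A : semigroupType) (E : set A) : Prop :=
  forall x y, E x -> E y -> x * y = x.

Definition zero_semigroup (T : magmaType) : Prop :=
  exists z : T, (forall x, z * x = z /\ x * z = z) /\ forall x y, x * y = z.

(* The Rees factor A/I: the elements outside I, together with one further
   element [None] to which I is collapsed. *)
Definition rees (A : semigroupType) (I : set A) : Type := option {x : A | ~ I x}.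

Definition rees_proj (A : semigroupType) (I : set A) (x : A) : rees I :=
  match pselect (I x) with
  | left _ => None
  | right nIx => Some (exist _ x nIx)
  end.

Definition rees_mul (A : semigroupType) (I : set A) (u v : rees I) : rees I :=
  match u, v with
  | Some x, Some y => rees_proj I (sval x * sval y)
  | _, _ => None
  end.

HB.instance Definition _ (A : semigroupType) (I : set A) :=
  hasMul.Build (rees I) (@rees_mul A I).

Definition retract_hom (A : semigroupType) (E : set A) (phi : A -> A) : Prop :=
  [/\ {morph phi : x y / x * y}, range phi = E & forall x, E x -> phi x = x].

Definition retract_ext (A : semigroupType) (E : set A) (phi : A -> A) : Prop :=
  [/\ ideal E, left_zero E, zero_semigroup (rees E) & retract_hom E phi].

(* The disjoint union of A and B, in which the product x y depends only on x
   and on the summand containing y: it is fAA x or fAB x for x in A and fBA x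
   or fBB x for x in B. For the four families below this is a semigroup. *)
Definition union_magma (A B : Type) (fAA fAB : A -> A + B)
  (fBA fBB : B -> A + B) : Type := (A + B)%type.

Definition union_mul (A B : Type) (fAA fAB : A -> A + B)
    (fBA fBB : B -> A + B) (x y : union_magma fAA fAB fBA fBB) :
    union_magma fAA fAB fBA fBB :=
  match x, y with
  | inl a, inl _ => fAA a
  | inl a, inr _ => fAB a
  | inr b, inl _ => fBA b
  | inr b, inr _ => fBB b
  end.

HB.instance Definition _ (A B : Type) (fAA fAB : A -> A + B)
    (fBA fBB : B -> A + B) :=
  hasMul.Build (union_magma fAA fAB fBA fBB) (@union_mul A B fAA fAB fBA fBB).

Definition type1_data (A B : semigroupType) (EA : set A) (EB : set B)
    (phiA : A -> A) (phiB : B -> B) (alpha : A -> B) (beta : B -> B) : Prop :=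
  [/\ retract_ext EA phiA /\ retract_ext EB phiB,
      {morph alpha : x y / x * y} /\ (forall a, EB (alpha a)),
      {morph beta : x y / x * y} /\ (forall b, EB b -> beta b = b),
      alpha \o phiA = alpha
    & beta \o beta = beta /\ phiB \o beta = phiB].

Definition type1 (A B : semigroupType) (phiA : A -> A) (phiB : B -> B)
    (alpha : A -> B) (beta : B -> B) : magmaType :=
  @union_magma A B (inl \o phiA) (inr \o alpha) (inr \o beta) (inr \o phiB).

Definition type2_data (A : Type) (B : semigroupType) (EB : set B)
    (phiB : B -> B) (alpha beta : A -> B) (gamma : B -> B) : Prop :=
  [/\ retract_ext EB phiB /\ [set: A] !=set0,
      (forall a, EB (beta a)),
      {morph gamma : x y / x * y} /\ (forall b, EB b -> gamma b = b),
      alpha <> beta \/ gamma <> phiB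
    & [/\ phiB \o alpha = beta, beta = gamma \o alpha,
          phiB \o gamma = phiB & phiB = gamma \o gamma]].

Definition type2 (A : Type) (B : semigroupType)
    (phiB : B -> B) (alpha beta : A -> B) (gamma : B -> B) : magmaType :=
  @union_magma A B (inr \o alpha) (inr \o beta) (inr \o gamma) (inr \o phiB).

Definition type3_data (A : semigroupType) (B : Type) (EA : set A)
    (phiA : A -> A) (alpha : A -> B) (gamma : B -> A) : Prop :=
  [/\ retract_ext EA phiA /\ [set: B] !=set0,
      (forall b, EA (gamma b)),
      alpha = alpha \o phiA
    & gamma \o alpha = phiA].

Definition type3 (A : semigroupType) (B : Type)
    (phiA : A -> A) (alpha : A -> B) (gamma : B -> A) : magmaType :=
  let beta := alpha \o gamma in
  @union_magma A B (inl \o phiA) (inr \o alpha) (inr \o beta) (inl \o gamma).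

Definition type4_data (A B : semigroupType) (EA : set A) (EB : set B)
    (phiA : A -> A) (phiB : B -> B) (alpha : A -> B) (beta : B -> A) : Prop :=
  [/\ retract_ext EA phiA /\ retract_ext EB phiB,
      {morph alpha : x y / x * y} /\ (forall a, EB (alpha a)),
      {morph beta : x y / x * y} /\ (forall b, EA (beta b)),
      [/\ alpha \o phiA = alpha, alpha = phiB \o alpha,
          beta \o phiB = beta & beta = phiA \o beta]
    & alpha \o beta = phiB /\ beta \o alpha = phiA].

Definition type4 (A B : semigroupType) (phiA : A -> A) (phiB : B -> B)
    (alpha : A -> B) (beta : B -> A) : magmaType :=
  @union_magma A B (inl \o phiA) (inr \o alpha) (inl \o beta) (inr \o phiB).

Definition same_finite_card (A B : Type) : Prop :=
  [/\ finite_set [set: A], finite_set [set: B] & ([set: A] #= [set: B])%card].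

(* Main.v *)
(* Index 2 means that S is coloured by c : S -> bool with theta a b iff
   c a = c b, so that s * x depends only on s and c x, and P_theta = 1/2 says that the two
   colour classes, of sizes p and q, satisfy 2 (p^2 + q^2) = (p + q)^2, that is
   p = q.  The quotient S/theta is a two-element semigroup: a semilattice, a
   zero semigroup, Z/2, a right zero semigroup or a left zero semigroup.  Mediality
   excludes the last one; the others give Types 1 to 4 with A, B the colour
   classes, all maps being right translations by a fixed a in A or b in B, so
   that every required identity is (x y) z = x (y z) together with the colour of
   y z.  Conversely, each type is coloured by its two summands, and S is medial
   because x y b and y x b always have the same colour. *)

From HB Require Import structures.
Require Import Defs.
From mathcomp Require Import all_boot all_order all_algebra finmap.
From mathcomp Require Import boolp classical_sets functions cardinality.
From mathcomp Require Import ring lra.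

Set Implicit Arguments.
Unset Strict Implicit.
Unset Printing Implicit Defensive.

Import GRing.Theory Num.Theory.
Local Open Scope classical_set_scope.
Local Open Scope group_scope.

(** * Index 2 as a two-colouring *)

Definition theta_colouring (S : semigroupType) (c : pred S) : Prop :=
  [/\ exists x, c x, exists x, ~~ c x & forall x y, theta x y <-> c x = c y].

(** Lets the two colours be exchanged when the quotient is matched with a table. *)
Lemma theta_colouringC (S : semigroupType) (c : pred S) :
  theta_colouring c -> theta_colouring (predC c).
Proof.
move=> [[x cx] [y cy] cP]; split; [by exists y | by exists x; rewrite /= cx |].
by move=> u v; rewrite cP /=; split=> [->//|/negb_inj].
Qed.

(** A numbering of the classes colours an element by whether its class has number 0; conversely, the
    two colour fibres are the classes. *)
Lemma theta_index_is2P (S : semigroupType) :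
  theta_index_is S 2 <-> exists c : pred S, theta_colouring c.
Proof.
split=> [/card_set_bijP[f [fS finj fsurj]]|[c [[x cx] [y cy] cP]]].
  pose cl (x : S) : set S := [set b | theta x b].
  have cl_in (x : S) : theta_classes S (cl x) by exists x.
  have thetaP (x y : S) : theta x y <-> f (cl x) = f (cl y).
    split=> [xy|/finj e].
      by congr f; apply/seteqP; split=> z /= h s; rewrite -h xy.
    have : cl y y by [].
    by rewrite -e ?inE //; exact: cl_in.
  exists (fun x => f (cl x) == 0%N); split.
  - by have [_ [x _ <-] e] := fsurj 0%N isT; exists x; apply/eqP.
  - by have [_ [x _ <-] e] := fsurj 1%N isT; exists x; rewrite /= e.
  (* Class numbers are below 2, hence determined by whether they are 0. *)
  - move=> x y; rewrite thetaP; have := fS _ (cl_in x); have := fS _ (cl_in y).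
    by rewrite /=; case: (f _) => [|[]//]; case: (f _) => [|[]//].
rewrite /theta_index_is.
have -> : theta_classes S = (fun i => [set z | c z = (i == 0%N)]) @` `I_2.
  apply/seteqP; split=> [_ [z _ <-]|_ [i i2 <-]].
    exists (~~ c z : nat) => /=; first by case: (c z).
    by apply/seteqP; split=> t /=; rewrite cP; case: (c z).
  case: i i2 => [|[|i]] //= _; [exists x => //|exists y => //];
    by apply/seteqP; split=> t /=; rewrite cP ?cx ?(negbTE cy).
(* The element [x] lies in the fibre numbered 0 and not in the one numbered 1. *)
apply: inj_card_eq => -[|[|i]] [|[|j]]; rewrite !inE //= => _ _ e.
  by have := congr1 (@^~ x) e; rewrite /= cx propeqE => -[/(_ erefl)].
by have := congr1 (@^~ x) e; rewrite /= cx propeqE => -[_ /(_ erefl)].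
Qed.

(** * Counting theta-related pairs *)

Lemma card_fset_setU (T : choiceType) (X Y : set T) :
  finite_set X -> finite_set Y -> X `&` Y = set0 ->
  #|` fset_set (X `|` Y)| = (#|` fset_set X| + #|` fset_set Y|)%N.
Proof.
move=> fX fY XY; rewrite fset_setU // cardfsU -fset_setI // XY fset_set0.
by rewrite cardfs0 subn0.
Qed.

Lemma card_fset_setX (T : choiceType) (X Y : set T) :
  finite_set X -> finite_set Y ->
  #|` fset_set (X `*` Y)| = (#|` fset_set X| * #|` fset_set Y|)%N.
Proof.
move=> fX fY; rewrite fset_setX // -(size_allpairs pair).
apply/perm_size/uniq_perm.
- exact: fset_uniq.
- by apply: allpairs_uniq; rewrite ?fset_uniq // => -[? ?] [? ?].
move=> [x y]; rewrite in_fsetM /=; apply/andP/allpairsP => [[xX yY]|].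
  by exists (x, y).
by move=> [[u v] /= [uX vY [-> ->]]].
Qed.

(** Clearing denominators turns the equation into (p - q)^2 = 0; positivity of p keeps p + q
    nonzero. *)
Lemma sum_squares_ratio_half (p q : nat) : (0 < p)%N ->
  ((p * p + q * q)%:R / (p + q)%:R ^+ 2 = 1 / 2 :> rat)%R <-> p = q.
Proof.
move=> p0; rewrite !natrD !natrM.
have x0 : (0 < p%:R :> rat)%R by rewrite ltr0n.
have y0 : (0 <= q%:R :> rat)%R by rewrite ler0n.
split=> [|<-]; last by field; lra.
have d0 : (p%:R + q%:R != 0 :> rat)%R by lra.
move/eqP; rewrite eqr_div ?sqrf_eq0 // => /eqP e.
apply/eqP; rewrite -(eqr_nat rat) -subr_eq0 -sqrf_eq0; apply/eqP; lra.
Qed.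

(** For the colour classes P and Q, theta is the disjoint union of the squares of P and Q, so it has
    p^2 + q^2 pairs. *)
Lemma theta_prob_halfP (S : semigroupType) (c : pred S) :
  theta_colouring c -> finite_set [set: S] ->
  theta_prob S = (1 / 2)%R <->
    ([set x | c x] #= [set x | ~~ c x])%card.
Proof.
move=> [[x cx] _ cP] finS.
have fin (X : set S) : finite_set X by apply: sub_finite_set finS.
pose P := [set z | c z]; pose Q := [set z | ~~ c z].
have PQ : P `&` Q = set0 by apply/seteqP; split=> z // -[/= cz /negP].
have ST : [set: S] = P `|` Q.
  by apply/seteqP; split=> z // _; have [|] := boolP (c z); [left|right].
have thetaE : [set p : S * S | theta p.1 p.2] = P `*` P `|` Q `*` Q.
  apply/seteqP; split=> -[u v]; rewrite /setX /P /Q /= cP.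
    by move=> ->; case: (c v); [left|right].
  by case=> -[]; case: (c u); case: (c v).
have PPQQ : P `*` P `&` Q `*` Q = set0.
  apply/seteqP; split=> -[u v] //= [[uP _] [uQ _]].
  by have : (P `&` Q) u by []; rewrite PQ.
have finX (X Y : set S) : finite_set (X `*` Y) by apply: finite_setX.
rewrite /theta_prob thetaE ST !card_fset_setU ?card_fset_setX //.
set p := #|` fset_set P|; set q := #|` fset_set Q|.
have p0 : (0 < p)%N.
  by rewrite cardfs_gt0; apply/fset0Pn; exists x; rewrite in_fset_set // inE.
apply: iff_trans (rwP (fcard_eq (fin P) (fin Q))).
exact: sum_squares_ratio_half.
Qed.

(** * The multiplication table of the quotient *)

Lemma theta_mul (S : semigroupType) (x x' y y' : S) :
  theta x x' -> theta y y' -> theta (x * y) (x' * y').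
Proof. by move=> xx' yy' s; rewrite !mulgA xx' yy'. Qed.

(** As theta is a congruence, [m] can be computed on one representative of each colour; it inherits
    associativity from S. *)
Lemma colouring_mulP (S : semigroupType) (c : pred S) : theta_colouring c ->
  exists m : bool -> bool -> bool,
    (forall x y, c (x * y) = m (c x) (c y)) /\
    (forall i j k, m (m i j) k = m i (m j k)).
Proof.
move=> [[a ca] [b cb] cP]; pose r (i : bool) := if i then a else b.
have cr i : c (r i) = i by case: i => //=; apply: negbTE.
have cM x y : c (x * y) = c (r (c x) * r (c y)).
  by apply/cP; apply: theta_mul; apply/cP; rewrite cr.
exists (fun i j => c (r i * r j)); split=> // i j k.
by rewrite -[k in LHS]cr -[i in RHS]cr -!cM mulgA.
Qed.

(* If the colour of a product is that of its left factor, then [s a b x] and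
   [s b a x] have the colours of [a] and [b], so mediality gives [s a = s b]. *)
Lemma medial_not_left (S : semigroupType) (c : pred S) :
  medial S -> theta_colouring c -> ~ forall x y, c (x * y) = c x.
Proof.
move=> med [[a ca] [b cb] cP] cM.
have aba : theta a (a * b * a) by apply/cP; rewrite !cM.
have baa : theta b (b * a * a) by apply/cP; rewrite !cM.
have : theta a b by move=> s; rewrite (aba s) (baa s) !mulgA; exact: med.
by rewrite cP ca (negbTE cb).
Qed.

(* The possible tables of S/theta, up to exchanging the two colours: the left
   zero table is excluded by [medial_not_left]. *)
Variant product_rule (S : semigroupType) (c : pred S) : Prop :=
| Semilattice of forall x y, c (x * y) = c x && c y
| Null of forall x y, c (x * y) = false
| Cyclic of forall x y, c (x * y) = (c x == c y)
| RightZero of forall x y, c (x * y) = c y.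

(** Checks a product rule on the four known entries of the table. *)
Local Ltac table :=
  match goal with tt : _ true true = _, tf : _ true false = _,
      ft : _ false true = _, ff : _ false false = _,
      cM : forall x y, _ (x * y) = _ |- _ =>
    by move=> x y; rewrite /= cM; case: (_ x); case: (_ y);
      rewrite ?(tt, tf, ft, ff)
  end.

(** Of the sixteen Boolean tables, the eight instances of associativity leave eight: left zero,
    which mediality excludes, and seven that fit a rule for [c] or for its complement. *)
Lemma product_rule_exists (S : semigroupType) (c : pred S) :
  medial S -> theta_colouring c ->
  exists2 d : pred S, theta_colouring d & product_rule d.
Proof.
move=> med cc; have [m [cM mA]] := colouring_mulP cc.
have ccC := theta_colouringC cc.
have := mA true true true; have := mA true true false.
have := mA true false true; have := mA false true true.
have := mA true false false; have := mA false true false.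
have := mA false false true; have := mA false false false.
case tt: (m true true); case tf: (m true false);
  case ft: (m false true); case ff: (m false false);
  rewrite !(tt, tf, ft, ff) // => _ _ _ _ _ _ _ _;
  (* This closes the left zero table, where [m i j = i]. *)
  try (by case: (medial_not_left med cc) => x y;
         rewrite cM; case: (c x); case: (c y); rewrite ?(tt, tf, ft, ff));
  (* If no rule fits [c], backtracking tries the complement. *)
  solve [((exists c => //) + (exists (predC c) => //));
    first [apply: Semilattice; table | apply: Null; table
          | apply: Cyclic; table | apply: RightZero; table]].
Qed.

(** Under [RightZero] the colour of a product is that of its last factor; the other tables are
    commutative. *)
Lemma medial_colouring (S : semigroupType) (c : pred S) :
  theta_colouring c -> product_rule c -> medial S.
Proof.
move=> [_ _ cP] rule a x y b.
suff : theta (x * y * b) (y * x * b) by move/(_ a); rewrite !mulgA.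
by apply/cP; case: rule => cM; rewrite !cM //; case: (c x); case: (c y).
Qed.

(** * From a disjoint union to the properties of S *)

Section Union.
Variables (S : semigroupType) (A B : Type).
Variables (fAA fAB : A -> A + B) (fBA fBB : B -> A + B).
Let U : magmaType := @union_magma A B fAA fAB fBA fBB.

Definition in_left (u : A + B) : bool := if u is inl _ then true else false.

(** A product depends on its right factor only through the summand containing it, so elements of one
    summand are related; an element on which two of the maps differ separates the summands. *)
Lemma colouring_of_union (g : S -> U) :
  bijective g -> {morph g : x y / x * y} ->
  [set: A] !=set0 -> [set: B] !=set0 ->
  (exists a, fAA a <> fAB a) \/ (exists b, fBA b <> fBB b) ->
  theta_colouring (fun x => in_left (g x)).
Proof.
move=> [h gK hK] gM [a _] [b _] sep; split.
- by exists (h (inl a)); rewrite hK.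
- by exists (h (inr b)); rewrite hK.
have mulE (u v w : U) : in_left v = in_left w -> u * v = u * w.
  by case: u => ?; case: v => ?; case: w.
move=> x y; split=> [xy|e s]; last first.
  by apply: (can_inj gK); rewrite !gM; apply: mulE.
(* Every [u] is a value of [g], so the relation carries over to the union. *)
have {}xy (u : U) : u * g x = u * g y by rewrite -[u]hK -!gM xy.
by case: sep => -[z ne]; [have := xy (inl z)|have := xy (inr z)];
  case: (g x) => ?; case: (g y) => ? // e; case: ne;
  (exact: e || exact: esym e).
Qed.

Lemma card_colour_union (g : S -> U) : bijective g ->
  ([set x | in_left (g x)] #= [set: A])%card /\
  ([set x | ~~ in_left (g x)] #= [set: B])%card.
Proof.
move=> [h gK hK]; split.
- have -> : [set x | in_left (g x)] = [set h (inl a) | a in [set: A]].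
    apply/seteqP; split=> [x|_ [a _ <-]] /=; last by rewrite hK.
    by case E: (g x) => [a|//] _; exists a; rewrite // -E gK.
  by apply: inj_card_eq => a b _ _ /(can_inj hK) [].
- have -> : [set x | ~~ in_left (g x)] = [set h (inr b) | b in [set: B]].
    apply/seteqP; split=> [x|_ [b _ <-]] /=; last by rewrite hK.
    by case E: (g x) => [//|b] _; exists b; rewrite // -E gK.
  by apply: inj_card_eq => a b _ _ /(can_inj hK) [].
Qed.

(** Common converse for the four types: each has only to provide a separating element and its table.
    The table is asked of every morphism [g], since the isomorphism is unpacked only in the
    proof. *)
Lemma union_characterisation :
  isomorphic S U -> same_finite_card A B ->
  [set: A] !=set0 -> [set: B] !=set0 ->
  (exists a, fAA a <> fAB a) \/ (exists b, fBA b <> fBB b) ->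
  (forall g : S -> U, {morph g : x y / x * y} ->
    product_rule (fun x => in_left (g x))) ->
  [/\ finite_set [set: S], medial S, theta_index_is S 2
    & theta_prob S = (1 / 2)%R].
Proof.
move=> [g gbij gM] [finA finB cardAB] A0 B0 sep rule.
have cc := colouring_of_union gbij gM A0 B0 sep.
have [cardA cardB] := card_colour_union gbij.
have finS : finite_set [set: S].
  have -> : [set: S] = [set x | in_left (g x)] `|` [set x | ~~ in_left (g x)].
    apply/seteqP; split=> x // _.
    by case: (boolP (in_left (g x))); [left|right].
  by rewrite finite_setU (eq_finite_set cardA) (eq_finite_set cardB).
split=> //.
- exact: medial_colouring (rule g gM).
- by apply/theta_index_is2P; exists (fun x => in_left (g x)).
- apply/(theta_prob_halfP cc finS).
  exact: card_eq_trans cardA (card_eq_trans cardAB (card_esym cardB)).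
Qed.

End Union.

(** * Retract extensions, subsemigroups and right translations *)

Lemma rees_proj_in (A : semigroupType) (I : set A) (x : A) :
  I x -> rees_proj I x = None.
Proof. by rewrite /rees_proj; case: (pselect (I x)). Qed.

(** Associativity makes [phi] idempotent, since (x a) a = x (a a); all products lie in its range, so
    they collapse to zero in the Rees factor. *)
Lemma retract_ext_range (A : semigroupType) (phi : A -> A) :
  [set: A] !=set0 -> (forall x y, x * y = phi x) -> retract_ext (range phi) phi.
Proof.
move=> [a _] mulE.
have phiphi x : phi (phi x) = phi x.
  by rewrite -[in LHS](mulE x a) -(mulE _ a) -mulgA !mulE.
split.
- split=> [|_ x [y _ <-]]; first by exists (phi a); exists a.
  by rewrite !mulE; split; [by exists x | by exists (phi y)].
- by move=> _ y [x _ <-] _; rewrite mulE.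
- exists None; split=> [[x|]|[x|] [y|]] //=.
  by apply: rees_proj_in; exists (sval x); rewrite ?mulE.
- by split=> // [x y|_ [x _ <-]]; rewrite ?mulE.
Qed.

(** The closure proof is an argument of the type so that the semigroup instance can recover it. *)
Definition subsemigroup (S : semigroupType) (P : pred S) (_ : mulg_closed P) :=
  {x : S | P x}.

Section Subsemigroup.
Variables (S : semigroupType) (P : pred S) (closedP : mulg_closed P).
HB.instance Definition _ := SubChoice.on (subsemigroup closedP).
HB.instance Definition _ :=
  SubChoice_isSubSemigroup.Build S P (subsemigroup closedP) closedP.
End Subsemigroup.

Definition rtransl (S : semigroupType) (P Q : pred S) (b : S)
    (PQ : forall x, P x -> Q (x * b)) (x : {x | P x}) : {x | Q x} :=
  exist _ (val x * b) (PQ _ (valP x)).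

(** * S as the disjoint union of its colour classes *)

Section Colouring.
Variables (S : semigroupType) (c : pred S).
Local Notation A := {x : S | c x}.
Local Notation B := {x : S | ~~ c x}.

Definition colour_val (u : A + B) : S :=
  match u with inl x => val x | inr x => val x end.

Lemma colour_val_bij : bijective colour_val.
Proof.
have split_ex x : exists u, colour_val u = x.
  case: (boolP (c x)) => cx; first by exists (inl (exist _ x cx)).
  by exists (inr (exist _ x cx)).
have [f fE] := choice split_ex; exists f => [u|//].
have := fE (colour_val u); case: (f _) => -[x cx]; case: u => -[y cy] /= e.
- by congr inl; apply: val_inj.
- by exfalso; have := cy; rewrite -e cx.
- by exfalso; have := cx; rewrite e cy.
- by congr inr; apply: val_inj.
Qed.

Lemma isomorphic_union (fAA fAB : A -> A + B) (fBA fBB : B -> A + B) :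
  (forall u v : union_magma fAA fAB fBA fBB,
     colour_val (u * v) = colour_val u * colour_val v) ->
  isomorphic S (union_magma fAA fAB fBA fBB).
Proof.
move=> valM; have [f fK Kf] := colour_val_bij.
exists f; first by exists colour_val.
by move=> x y; apply: (can_inj fK); rewrite valM !Kf.
Qed.

Lemma same_finite_card_colours : finite_set [set: S] ->
  ([set x | c x] #= [set x | ~~ c x])%card -> same_finite_card A B.
Proof.
move=> finS eqcard.
have cardT (P : pred S) : ([set: {x | P x}] #= [set x | P x])%card.
  have -> : [set x | P x] = [set val x | x in [set: {x | P x}]].
    apply/seteqP; split=> [x Px|_ [x _ <-]]; last exact: valP.
    by exists (exist _ x Px).
  by apply: card_esym; apply: inj_card_eq => x y _ _; exact: val_inj.
have fin (P : pred S) : finite_set [set: {x | P x}].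
  by rewrite (eq_finite_set (cardT P)); apply: sub_finite_set finS.
split=> //; apply: card_eq_trans (cardT c) _.
exact: card_eq_trans eqcard (card_esym (cardT (fun x => ~~ c x))).
Qed.

End Colouring.

Lemma comp_apply (T U V : Type) (f : U -> V) (g : T -> U) (h : T -> V) :
  f \o g = h -> forall x, f (g x) = h x.
Proof. by move=> <-. Qed.

(** When x y = phi x on both sides, f (x y) = f x f y says exactly that f commutes with the
    retractions. *)
Lemma range_morph (A B : semigroupType) (phiA : A -> A) (phiB : B -> B)
    (f : A -> B) :
  (forall x y, x * y = phiA x) -> (forall x y, x * y = phiB x) ->
  f \o phiA = phiB \o f -> {morph f : x y / x * y}.
Proof.
by move=> mulA mulB fphi x y; rewrite mulA mulB; exact: comp_apply fphi x.
Qed.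

(** * The type produced by each table *)

Section Types.
Variables (S : semigroupType) (c : pred S).
Hypothesis colc : theta_colouring c.
Local Notation A := {x : S | c x}.
Local Notation B := {x : S | ~~ c x}.

Let cmul (s x y : S) : c x = c y -> s * x = s * y.
Proof. by case: colc => _ _ cP /cP. Qed.

(** Since (t x) y = t (x y) depends only on t and the colour of x y, each identity between structure
    maps becomes a computation of colours. *)
Lemma rtransl_comp (P Q R : pred S) (x y z : S)
    (PQ : forall t, P t -> Q (t * x)) (QR : forall t, Q t -> R (t * y))
    (PR : forall t, P t -> R (t * z)) :
  c (x * y) = c z -> rtransl QR \o rtransl PQ = rtransl PR.
Proof.
by move=> e; apply/funext => t; apply: val_inj; rewrite /= -mulgA; exact: cmul.
Qed.

Lemma subsemigroup_mulE (P : pred S) (i : bool) (closedP : mulg_closed P)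
    (x : S) (PP : forall t, P t -> P (t * x)) :
  (forall t, P t -> c t = i) -> c x = i ->
  forall u v : subsemigroup closedP, u * v = rtransl PP u.
Proof.
move=> cP cx u v; apply: val_inj; rewrite valM; apply: cmul.
by rewrite cx; apply: cP; exact: valP.
Qed.

Lemma subsemigroup_neq0 (P : pred S) (closedP : mulg_closed P) (x : S) :
  P x -> [set: subsemigroup closedP] !=set0.
Proof. by move=> Px; exists (exist _ x Px). Qed.

Variables (a b : S).
Hypotheses (ca : c a) (cb : ~~ c b).

(** Any right factor may be replaced by whichever of [a] and [b] has its colour. *)
Lemma colours_isomorphic (fAA fAB : A -> A + B) (fBA fBB : B -> A + B) :
  (forall x, colour_val (fAA x) = val x * a) ->
  (forall x, colour_val (fAB x) = val x * b) ->
  (forall x, colour_val (fBA x) = val x * a) ->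
  (forall x, colour_val (fBB x) = val x * b) ->
  isomorphic S (union_magma fAA fAB fBA fBB).
Proof.
move=> hAA hAB hBA hBB; apply: isomorphic_union.
by move=> -[x|x] [y|y]; rewrite /mul /= ?(hAA, hAB, hBA, hBB); apply: cmul;
  rewrite ?ca ?(valP y) // (negbTE cb) (negbTE (valP y)).
Qed.

Hypotheses (finS : finite_set [set: S])
  (card_c : ([set x | c x] #= [set x | ~~ c x])%card).

Lemma semilattice_type1 :
  (forall x y, c (x * y) = c x && c y) ->
  exists (A B : semigroupType) (EA : set A) (EB : set B)
    (phiA : A -> A) (phiB : B -> B) (alpha : A -> B) (beta : B -> B),
    [/\ type1_data EA EB phiA phiB alpha beta,
        isomorphic S (type1 phiA phiB alpha beta)
      & same_finite_card A B].
Proof.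
move=> cM.
have closedA : mulg_closed c by move=> x y; rewrite /in_mem /= cM => -> ->.
have closedB : mulg_closed [pred x | ~~ c x].
  by move=> x y; rewrite /in_mem /= cM => /negbTE->.
have AA x : c x -> c (x * a) by rewrite cM => ->.
have AB x : c x -> ~~ c (x * b) by rewrite cM (negbTE cb) andbF.
have BA x : ~~ c x -> ~~ c (x * a) by rewrite cM => /negbTE->.
have BB x : ~~ c x -> ~~ c (x * b) by rewrite cM => /negbTE->.
pose SA := subsemigroup closedA; pose SB := subsemigroup closedB.
pose phiA : SA -> SA := rtransl AA; pose phiB : SB -> SB := rtransl BB.
pose alpha : SA -> SB := rtransl AB; pose beta : SB -> SB := rtransl BA.
have mulA : forall x y : SA, x * y = phiA x.
  by apply: (subsemigroup_mulE _ (i := true)).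
have mulB : forall x y : SB, x * y = phiB x.
  by apply: (subsemigroup_mulE _ (i := false)) => [t /negbTE|] //;
    exact: negbTE.
have alphaA : alpha \o phiA = alpha by apply: rtransl_comp; rewrite cM ca.
have alphaB : phiB \o alpha = alpha.
  by apply: rtransl_comp; rewrite cM (negbTE cb).
have betaB : phiB \o beta = phiB by apply: rtransl_comp; rewrite cM ca.
have Bbeta : beta \o phiB = phiB by apply: rtransl_comp; rewrite cM (negbTE cb).
exists SA, SB, (range phiA), (range phiB), phiA, phiB, alpha, beta; split.
- split; first split.
  + by apply: (retract_ext_range _ mulA); exact: subsemigroup_neq0 ca.
  + by apply: (retract_ext_range _ mulB); exact: subsemigroup_neq0 cb.
  + split; first by apply: (range_morph mulA mulB); rewrite alphaA alphaB.
    (* [alpha x] is fixed by [phiB], hence lies in its range. *)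
    by move=> x; exists (alpha x) => //; exact: comp_apply alphaB x.
  + split; first by apply: (range_morph mulB mulB); rewrite betaB Bbeta.
    by move=> _ [x _ <-]; exact: comp_apply Bbeta x.
  + by [].
  + split=> //; by apply: rtransl_comp; rewrite cM ca.
- by apply: colours_isomorphic.
- exact: same_finite_card_colours.
Qed.
Lemma null_type2 :
  (forall x y, c (x * y) = false) ->
  exists (A : Type) (B : semigroupType) (EB : set B)
    (phiB : B -> B) (alpha beta : A -> B) (gamma : B -> B),
    [/\ type2_data EB phiB alpha beta gamma,
        isomorphic S (type2 phiB alpha beta gamma)
      & same_finite_card A B].
Proof.
move=> cM.
have closedB : mulg_closed [pred x | ~~ c x].
  by move=> x y; rewrite /in_mem /= cM.
have AB z x : c x -> ~~ c (x * z) by rewrite cM.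
have BB z x : ~~ c x -> ~~ c (x * z) by rewrite cM.
pose SB := subsemigroup closedB.
pose alpha : A -> SB := rtransl (AB a); pose beta : A -> SB := rtransl (AB b).
pose gamma : SB -> SB := rtransl (BB a); pose phiB : SB -> SB := rtransl (BB b).
have mulB : forall x y : SB, x * y = phiB x.
  by apply: (subsemigroup_mulE _ (i := false)) => [t /negbTE|] //;
    exact: negbTE.
have alphaB : phiB \o alpha = beta.
  by apply: rtransl_comp; rewrite cM (negbTE cb).
have gammaB : phiB \o gamma = phiB.
  by apply: rtransl_comp; rewrite cM (negbTE cb).
have Bgamma : gamma \o phiB = phiB.
  by apply: rtransl_comp; rewrite cM (negbTE cb).
exists A, SB, (range phiB), phiB, alpha, beta, gamma; split.
- split.
  + split; last by exists (exist _ a ca).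
    by apply: (retract_ext_range _ mulB); exact: subsemigroup_neq0 cb.
  + by move=> x; exists (alpha x) => //; exact: comp_apply alphaB x.
  + split; first by apply: (range_morph mulB mulB); rewrite gammaB Bgamma.
    by move=> _ [x _ <-]; exact: comp_apply Bgamma x.
  (* If both equalities held, [a] and [b] would act alike on the right of every element, although
     their colours differ. *)
  + apply: contrapT => /not_orP[/contrapT eA /contrapT eB].
    have : theta a b.
      move=> s; case: (boolP (c s)) => cs.
        exact: (congr1 (fun f => val (f (exist _ s cs))) eA).
      exact: (congr1 (fun f => val (f (exist _ s cs))) eB).
    by case: colc => _ _ cP; rewrite cP ca (negbTE cb).
  + split=> //; apply/esym; apply: rtransl_comp; rewrite cM (negbTE cb) //.
- by apply: colours_isomorphic.
- exact: same_finite_card_colours.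
Qed.

Lemma cyclic_type3 :
  (forall x y, c (x * y) = (c x == c y)) ->
  exists (A : semigroupType) (B : Type) (EA : set A)
    (phiA : A -> A) (alpha : A -> B) (gamma : B -> A),
    [/\ type3_data EA phiA alpha gamma,
        isomorphic S (type3 phiA alpha gamma)
      & same_finite_card A B].
Proof.
move=> cM.
have closedA : mulg_closed c by move=> x y; rewrite /in_mem /= cM => -> ->.
have AA x : c x -> c (x * a) by rewrite cM ca => ->.
have AB x : c x -> ~~ c (x * b) by rewrite cM (negbTE cb) => ->.
have BA x : ~~ c x -> c (x * b) by rewrite cM (negbTE cb) => /negbTE->.
have BB x : ~~ c x -> ~~ c (x * a) by rewrite cM ca => /negbTE->.
pose SA := subsemigroup closedA.
pose phiA : SA -> SA := rtransl AA.
pose alpha : SA -> B := rtransl AB; pose gamma : B -> SA := rtransl BA.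
have mulA : forall x y : SA, x * y = phiA x.
  by apply: (subsemigroup_mulE _ (i := true)).
have alphaA : alpha \o phiA = alpha.
  by apply: rtransl_comp; rewrite cM ca (negbTE cb).
have gammaA : phiA \o gamma = gamma.
  by apply: rtransl_comp; rewrite cM ca (negbTE cb).
(* b b has the colour of [a], so the prescribed beta is right translation by [a]. *)
have alphagamma : alpha \o gamma = rtransl BB.
  by apply: rtransl_comp; rewrite cM (negbTE cb) ca.
exists SA, B, (range phiA), phiA, alpha, gamma; split.
- split=> //.
  + split; last by exists (exist _ b cb).
    by apply: (retract_ext_range _ mulA); exact: subsemigroup_neq0 ca.
  + by move=> x; exists (gamma x) => //; exact: comp_apply gammaA x.
  + by apply: rtransl_comp; rewrite cM (negbTE cb) ca.
- by rewrite /type3 alphagamma; apply: colours_isomorphic.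
- exact: same_finite_card_colours.
Qed.

Lemma right_zero_type4 :
  (forall x y, c (x * y) = c y) ->
  exists (A B : semigroupType) (EA : set A) (EB : set B)
    (phiA : A -> A) (phiB : B -> B) (alpha : A -> B) (beta : B -> A),
    [/\ type4_data EA EB phiA phiB alpha beta,
        isomorphic S (type4 phiA phiB alpha beta)
      & same_finite_card A B].
Proof.
move=> cM.
have closedA : mulg_closed c by move=> x y; rewrite /in_mem /= cM.
have closedB : mulg_closed [pred x | ~~ c x].
  by move=> x y; rewrite /in_mem /= cM.
(* The colour of the left factor is irrelevant here, so these two facts type all four
   translations. *)
have toA (P : pred S) x : P x -> c (x * a) by rewrite cM.
have toB (P : pred S) x : P x -> ~~ c (x * b) by rewrite cM.
pose SA := subsemigroup closedA; pose SB := subsemigroup closedB.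
pose phiA : SA -> SA := rtransl (@toA _).
pose phiB : SB -> SB := rtransl (@toB _).
pose alpha : SA -> SB := rtransl (@toB _).
pose beta : SB -> SA := rtransl (@toA _).
have mulA : forall x y : SA, x * y = phiA x.
  by apply: (subsemigroup_mulE _ (i := true)).
have mulB : forall x y : SB, x * y = phiB x.
  by apply: (subsemigroup_mulE _ (i := false)) => [t /negbTE|] //;
    exact: negbTE.
have alphaA : alpha \o phiA = alpha by apply: rtransl_comp.
have alphaB : phiB \o alpha = alpha by apply: rtransl_comp.
have betaA : phiA \o beta = beta by apply: rtransl_comp.
have betaB : beta \o phiB = beta by apply: rtransl_comp.
exists SA, SB, (range phiA), (range phiB), phiA, phiB, alpha, beta; split.
- split.
  + split.
      by apply: (retract_ext_range _ mulA); exact: subsemigroup_neq0 ca.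
    by apply: (retract_ext_range _ mulB); exact: subsemigroup_neq0 cb.
  + split; first by apply: (range_morph mulA mulB); rewrite alphaA alphaB.
    by move=> x; exists (alpha x) => //; exact: comp_apply alphaB x.
  + split; first by apply: (range_morph mulB mulA); rewrite betaA betaB.
    by move=> x; exists (beta x) => //; exact: comp_apply betaA x.
  + by split.
  + by split; apply: rtransl_comp.
- by apply: colours_isomorphic.
- exact: same_finite_card_colours.
Qed.
End Types.

(** * The equivalence *)

Lemma retract_ext_neq0 (A : semigroupType) (E : set A) (phi : A -> A) :
  retract_ext E phi -> [set: A] !=set0.
Proof. by move=> [[[x _] _] _ _ _]; exists x. Qed.

Theorem theorem3p7 (S : semigroupType) (S_neq0 : [set: S] !=set0) :
  [/\ finite_set [set: S], medial S, theta_index_is S 2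
    & theta_prob S = (1 / 2)%R]
  <->
  [\/ exists (A B : semigroupType) (EA : set A) (EB : set B)
        (phiA : A -> A) (phiB : B -> B) (alpha : A -> B) (beta : B -> B),
        [/\ type1_data EA EB phiA phiB alpha beta,
            isomorphic S (type1 phiA phiB alpha beta)
          & same_finite_card A B],
      exists (A : Type) (B : semigroupType) (EB : set B)
        (phiB : B -> B) (alpha beta : A -> B) (gamma : B -> B),
        [/\ type2_data EB phiB alpha beta gamma,
            isomorphic S (type2 phiB alpha beta gamma)
          & same_finite_card A B],
      exists (A : semigroupType) (B : Type) (EA : set A)
        (phiA : A -> A) (alpha : A -> B) (gamma : B -> A),
        [/\ type3_data EA phiA alpha gamma,
            isomorphic S (type3 phiA alpha gamma)
          & same_finite_card A B]
    | exists (A B : semigroupType) (EA : set A) (EB : set B)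
        (phiA : A -> A) (phiB : B -> B) (alpha : A -> B) (beta : B -> A),
        [/\ type4_data EA EB phiA phiB alpha beta,
            isomorphic S (type4 phiA phiB alpha beta)
          & same_finite_card A B]].
Proof.
split=> [[finS medS /theta_index_is2P[c0 cc0] prob]|].
  have [c cc rule] := product_rule_exists medS cc0.
  have card_c := (theta_prob_halfP cc finS).1 prob.
  have [[a ca] [b cb] _] := cc.
  case: rule => cM.
  - exact/Or41/(semilattice_type1 cc ca cb).
  - exact/Or42/(null_type2 cc ca cb).
  - exact/Or43/(cyclic_type3 cc ca cb).
  - exact/Or44/(right_zero_type4 cc ca cb).
case.
- move=> [A] [B] [EA] [EB] [phiA] [phiB] [alpha] [beta].
  move=> [[[extA extB] _ _ _ _] iso card].
  have A0 := retract_ext_neq0 extA; have B0 := retract_ext_neq0 extB.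
  apply: (union_characterisation iso card A0 B0).
    (* The two products of [a] land in different summands, so any [a] separates. *)
    by left; case: A0 => a; exists a.
  by move=> g gM; apply: Semilattice => x y; rewrite gM;
    case: (g x); case: (g y).
- move=> [A] [B] [EB] [phiB] [alpha] [beta] [gamma].
  move=> [[[extB A0] _ _ neq _] iso card].
  have B0 := retract_ext_neq0 extB.
  apply: (union_characterisation iso card A0 B0).
    (* In Type 2 all products land in B, so separation comes from the assumed inequality of maps. *)
    case: neq => neq; [left|right]; apply: contrapT => /forallNP eq; apply: neq;
      apply/funext => x; have /contrapT := eq x; exact: inr_inj.
  by move=> g gM; apply: Null => x y; rewrite gM;
    case: (g x); case: (g y).
- move=> [A] [B] [EA] [phiA] [alpha] [gamma] [[[extA B0] _ _ _] iso card].
  have A0 := retract_ext_neq0 extA.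
  apply: (union_characterisation iso card A0 B0).
    by left; case: A0 => a; exists a.
  by move=> g gM; apply: Cyclic => x y; rewrite gM;
    case: (g x); case: (g y).
- move=> [A] [B] [EA] [EB] [phiA] [phiB] [alpha] [beta].
  move=> [[[extA extB] _ _ _ _] iso card].
  have A0 := retract_ext_neq0 extA; have B0 := retract_ext_neq0 extB.
  apply: (union_characterisation iso card A0 B0).
    by left; case: A0 => a; exists a.
  by move=> g gM; apply: RightZero => x y; rewrite gM;
    case: (g x); case: (g y).
Qed.
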